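(* Let $G$ be a finite group and suppose $g\in G$ and $\chi\in\mathrm{Irr}(G)$ are such that $\chi(g)\neq 0$. Let $n$ be the order of $g$, and let $n_0=\prod_{p\mid n}p$ (product over the primes $p$ dividing $n$) be the squarefree part of $n$. Then (i) $nn_0$ divides $\left(\frac{|G|}{\chi(1)}\right)^2$, and (ii) $n^3$ divides $\frac{|G|^3}{\chi(1)^2}$.
   Context: $\mathrm{Irr}(G)$ denotes the set of irreducible complex characters of the finite group $G$. *)

(* Defs.v *)
From mathcomp Require Import all_boot.

Set Implicit Arguments.
Unset Strict Implicit.
Unset Printing Implicit Defensive.

(* The radical of n: [primes n] lists each prime divisor of n once. *)
Definition squarefree_part (n : nat) : nat := \prod_(p <- primes n) p.

(* Main.v *)
Require Import Defs.
From mathcomp Require Import all_boot all_order all_algebra all_fingroup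
  all_solvable all_field all_character.
From mathcomp Require Import ring zify.

Set Implicit Arguments.
Unset Strict Implicit.
Unset Printing Implicit Defensive.

Import GroupScope Order.TTheory GRing.Theory Num.Theory.
Local Open Scope ring_scope.

(** Fix a prime p dividing the order n of g, put u = g_p (the p-part of g), U = <u>,
    |U| = p^a, m = |G| / chi(1), and let p^b and p^t be the p-parts of m and of
    k = |N_G(U) : C_G(U)|.  Everything follows from 2a <= t + 2b:
    N_G(U) / C_G(U) embeds in Aut U, of order p^(a-1) (p-1), so t <= a - 1 and
    a + 1 <= 2b, which is (i) at p; and U <= C_G(U) gives
    a + t <= e, hence 3a <= e + 2b, where p^e is the p-part of |G|; this is (ii)
    at p.

    To get 2a <= t + 2b, let W_v, for a generator v of U, be the sum of
    |chi(x)|^2 over the x in G whose p-part is conjugate to v (a p-section).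

    - Away from p, W_v is divisible by the p'-part of |G|
      ([dvdA_psection_norm_p'part]).  For a prime q <> p the indicator function of
      a p-section only depends on the q'-part of its argument, and a sum of
      character values weighted by such a function is divisible by the q-part
      of |G| ([dvdA_sum_mul_char]).
    - At p, the identity |C(x)| omega(x) = m chi(x), where omega is the
      (integral) central character, gives m^2 W_v / |G| as the sum over classes
      of |C(x)| |omega(x)|^2, and |U| divides each |C(x)|
      ([dvdA_psection_norm_irr]).

    By Bezout the number X_v = p^(2b) W_v / (|G| p^a) is an algebraic integer.
    Galois conjugation permutes the W_v by v |-> v^j, so the product of the X_v
    is a rational integer, and it is positive because chi(g) <> 0 forces
    chi(v g_p') <> 0 for each v.  By the arithmetic-geometric mean
    inequality the X_v then have mean at least 1.  On the other hand each x in G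
    contributes to at most k of the W_v and x = 1 to none, so the W_v add up
    to less than k |G|.  Comparing, phi(p^a) p^a < k p^(2b); as
    k <= p^t (p-1), this is 2a - 1 < t + 2b. *)

(** * Divisibility by natural numbers in the ring of algebraic integers *)

Lemma dvdA_natE (n : nat) (x : algC) :
  (0 < n)%N -> (n %| x)%A = (x / n%:R \in Aint).
Proof. by case: n => // n _; rewrite unfold_in /= pnatr_eq0. Qed.

Lemma dvdA_nat_trans (d n : nat) (x : algC) :
  (0 < n)%N -> (d %| n)%N -> (n %| x)%A -> (d %| x)%A.
Proof.
move=> + /dvdnP[k def_n]; rewrite def_n muln_gt0 => /andP[k_gt0 d_gt0].
rewrite !dvdA_natE ?muln_gt0 ?k_gt0 // => Ax.
have ->: x / d%:R = k%:R * (x / (k * d)%:R).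
  by rewrite natrM invfM mulrCA mulVKf // pnatr_eq0 -lt0n.
by rewrite rpredM ?rpred_nat.
Qed.

Lemma dvdA_mull (n : nat) (x y : algC) :
  x \in Aint -> (n %| y)%A -> (n %| x * y)%A.
Proof. by rewrite -!eqAmod0 => Ax /(eqAmodMl Ax); rewrite mulr0. Qed.

Lemma Gauss_dvdA (m n : nat) (x : algC) :
    (0 < m)%N -> (0 < n)%N -> coprime m n ->
  (m %| x)%A -> (n %| x)%A -> ((m * n)%N %| x)%A.
Proof.
move=> m_gt0 n_gt0 co_mn; rewrite !dvdA_natE ?muln_gt0 ?m_gt0 // => Am An.
have nz k : (0 < k)%N -> k%:R != 0 :> algC by rewrite pnatr_eq0 -lt0n.
case: (egcdnP n m_gt0) => u v; rewrite (eqP co_mn) => Duv _.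
suffices ->: x / (m * n)%:R = u%:R * (x / n%:R) - v%:R * (x / m%:R).
  by apply: rpredB; apply: rpredM; rewrite ?rpred_nat.
have{Duv}: u%:R * m%:R - v%:R * n%:R = 1 :> algC.
  by rewrite -natrM Duv natrD natrM; ring.
move: (nz _ m_gt0) (nz _ n_gt0); rewrite natrM => nz_m nz_n Duv.
transitivity ((u%:R * m%:R - v%:R * n%:R) * x / (m%:R * n%:R)).
  by rewrite Duv mul1r.
by field; exact/andP.
Qed.

Lemma dvdA_natM (m n : nat) (x : algC) :
  (0 < m)%N -> (0 < n)%N -> (n %| x)%A -> ((m * n)%N %| m%:R * x)%A.
Proof.
move=> m_gt0 n_gt0; rewrite !dvdA_natE ?muln_gt0 ?m_gt0 // natrM.
by rewrite -mulf_div divff ?mul1r // pnatr_eq0 -lt0n.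
Qed.

Lemma Gauss_dvdA_cancel (m n : nat) (x : algC) :
    (0 < m)%N -> (0 < n)%N -> coprime m n -> x \in Aint ->
  (m %| n%:R * x)%A -> (m %| x)%A.
Proof.
move=> m_gt0 n_gt0 co_mn Ax; rewrite !dvdA_natE // => Anx.
have nz_m : m%:R != 0 :> algC by rewrite pnatr_eq0 -lt0n.
case: (egcdnP m n_gt0) => u v; rewrite gcdnC (eqP co_mn) => Duv _.
suffices ->: x / m%:R = u%:R * (n%:R * x / m%:R) - v%:R * x.
  by apply: rpredB; apply: rpredM; rewrite ?rpred_nat.
have{Duv} Duv: u%:R * n%:R - v%:R * m%:R = 1 :> algC.
  by rewrite -natrM Duv natrD natrM; ring.
transitivity ((u%:R * n%:R - v%:R * m%:R) * x / m%:R); last by field.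
by rewrite Duv mul1r.
Qed.

Lemma dvdA_parts (n : nat) (x : algC) :
    (0 < n)%N -> x \in Aint -> (forall q, q \in primes n -> ((n`_q)%N %| x)%A) ->
  (n %| x)%A.
Proof.
move=> + Ax; elim/ltn_ind: n => n IHn n_gt0 n_parts.
have [n_gt1 | n_le1] := ltnP 1 n; last first.
  by rewrite dvdA_natE // (@anti_leq n 1) ?n_le1 // divr1.
have q_pr := pdiv_prime n_gt1; set q := pdiv n in q_pr.
have qn: q \in primes n by rewrite mem_primes q_pr n_gt0 pdiv_dvd.
rewrite -(partnC q n_gt0); apply: Gauss_dvdA; rewrite ?part_gt0 ?coprime_partC //.
  exact: n_parts.
apply: IHn => [||r]; rewrite ?part_gt0 //.
  rewrite -{2}(partnC q n_gt0) ltn_Pmull ?part_gt0 // p_part_gt1.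
  by rewrite mem_primes q_pr n_gt0 pdiv_dvd.
rewrite primes_part mem_filter => /andP[q'r nr].
by rewrite partn_part ?n_parts // => s /eqnP->.
Qed.

(** * Character sums over q-sections *)

(** The function induced from the trivial character is the permutation
    character of the action on right cosets. *)
Lemma cfInd_cfun1_fix (gT : finGroupType) (D Q : {group gT}) (w : gT) :
    Q \subset D -> w \in D ->
  'Ind[D, Q] 1 w = #|'Fix_(rcosets Q D | 'Rs)[w]%g|%:R.
Proof.
move=> sQD Dw; rewrite cfIndE //.
pose fixed A := A \in 'Fix_(rcosets Q D | 'Rs)[w]%g.
have ->: \sum_(y in D) (1 : 'CF(Q)) (w ^ y)%g
          = \sum_(y in D) (fixed (Q :* y)%g)%:R :> algC.
  rewrite (reindex_inj invg_inj) /=; apply: eq_big => [y | y].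
    by rewrite groupV.
  rewrite groupV => Dy; rewrite cfun1E; congr (_%:R); congr nat_of_bool.
  rewrite /fixed inE (sameP afix1P eqP) /= rcosetE -rcosetM.
  rewrite (sameP eqP rcoset_eqP) mem_rcoset conjgE invgK.
  by rewrite mulgA -rcosetE imset_f.
rewrite (partition_big (fun y => Q :* y)%g (mem (rcosets Q D))) /=; last first.
  by move=> y Dy; apply/rcosetsP; exists y.
rewrite (eq_bigr (fun A => (fixed A)%:R * #|Q|%:R)); last first.
  move=> A /rcosetsP[y Dy ->].
  rewrite (eq_bigr (fun=> (fixed (Q :* y)%g)%:R)) => [|z /andP[_ /eqP->] //].
  rewrite sumr_const mulr_natr; congr (_ *+ _); rewrite -(card_rcoset Q y).
  apply: eq_card => z; rewrite unfold_in /= (sameP eqP rcoset_eqP).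
  rewrite andb_idl // => /rcosetP[t Qt ->].
  by rewrite groupM // (subsetP sQD).
rewrite -mulr_suml mulrC mulfK ?neq0CG //.
rewrite -natr_sum -big_mkcondr sum1_card /=; congr _%:R; apply: eq_card => A.
by apply: andb_idl; rewrite /fixed inE => /andP[].
Qed.

(** A power of the permutation character on the cosets of a Sylow q-subgroup Q:
    that character vanishes off the conjugates of Q, and on a q-element it is
    congruent mod q to |D : Q|, a unit, so Euler's theorem makes a suitable
    power congruent to 1.  This elementary substitute for Brauer's
    characterization approximates the indicator of the q-elements q-adically. *)
Lemma pelt_indicator_char_exists (gT : finGroupType) (D : {group gT})
    (q e : nat) :
    prime q ->
  exists2 theta : 'CF(D), theta \is a character
    & {in D, forall w, (theta w == (q.-elt w)%:R %[mod (q ^ e)%N])%A}.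
Proof.
move=> q_pr; have [Q sylQ] := Sylow_exists q D; have sQD := pHall_sub sylQ.
have q'D : coprime q #|D : Q|.
  by rewrite prime_coprime // -p'natE //; case/and3P: sylQ.
exists ('Ind[D, Q] 1 ^+ totient (q ^ e)%N).
  by rewrite rpredX // cfInd_char // cfun1_char.
move=> w Dw; rewrite exp_cfunE // cfInd_cfun1_fix // -natrX eqAmod_nat; apply/eqP.
have [q_w | q'w] := boolP (q.-elt w).
  rewrite Euler_exp_totient // coprime_sym coprimeXl //.
  have fixQ: #|'Fix_(rcosets Q D | 'Rs)[w]%g| = #|D : Q| %[mod q].
    rewrite -afix_cycle // -(pgroup_fix_mod q_w) //.
    by apply: subset_trans (actsRs_rcosets Q D); rewrite cycle_subG.
  by rewrite coprime_sym -coprime_modl fixQ coprime_modl coprime_sym.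
rewrite eq_card0 ?exp0n ?totient_gt0 ?expn_gt0 ?prime_gt0 // => A.
apply: contraNF q'w; rewrite inE => /andP[/rcosetsP[y Dy ->] /afix1P].
rewrite /= rcosetE -rcosetM => /rcoset_eqP.
case/rcosetP=> t Qt Dyw; have ->: w = (t ^ y)%g by rewrite conjgE -Dyw mulKg.
by rewrite p_eltJ (mem_p_elt (pHall_pgroup sylQ)).
Qed.

(** Translating by a central z only scales an irreducible character by a root of
    unity, so this is the integrality of inner products of characters. *)
Lemma dvdA_sum_irr_mul_char (gT : finGroupType) (D : {group gT}) (theta : 'CF(D))
    (j : Iirr D) (z : gT) :
    theta \is a character -> z \in 'Z(D) ->
  (#|D| %| \sum_(w in D) 'chi_j (w * z)%g * theta w^-1%g)%A.
Proof.
move=> /char_sum_irr[r ->] /centerP[Dz cDz].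
rewrite (eq_bigr (fun w => \sum_(k <- r) 'chi_j (w * z)%g * 'chi_k w^-1%g));
  last first.
  by move=> w _; rewrite sum_cfunE mulr_sumr.
rewrite exchange_big rpred_sum // => k _.
rewrite (canRL (mulVKf (neq0CG D)) (generalized_orthogonality_relation z j k)).
have zD1: #|z ^: D| = 1%N.
  apply/eqP; rewrite -index_cent1 indexg_eq1 subsetI subxx /=.
  by apply/subsetP=> x Dx; rewrite cent1E; apply/eqP/esym/cDz.
have Aomega: 'chi_j z / 'chi_j 1%g \in Aint.
  by have:= Aint_class_div_irr1 j Dz; rewrite zD1 mul1r.
by rewrite -eqAmod0 eqAmodMr0 // rpredM ?rpred_nat.
Qed.

(** A weighted form of Frobenius' theorem counting the q-elements of a group. *)
Lemma dvdA_sum_pelt_irr (gT : finGroupType) (D : {group gT}) (q : nat)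
    (j : Iirr D) (z : gT) :
    prime q -> z \in 'Z(D) ->
  ((#|D|`_q)%N %| \sum_(w in D | q.-elt w) 'chi_j (w * z)%g)%A.
Proof.
move=> q_pr Zz; have Dz := subsetP (center_sub D) z Zz.
rewrite p_part; set e := logn q _.
have [theta Ntheta theta_mod] := pelt_indicator_char_exists D e q_pr.
have: (#|D| %| \sum_(w in D) 'chi_j (w * z)%g * theta w^-1%g)%A.
  exact: dvdA_sum_irr_mul_char.
have D_theta: (q ^ e %| #|D|)%N by rewrite pfactor_dvdnn.
move/(dvdA_nat_trans (cardG_gt0 D) D_theta).
rewrite -!eqAmod0; apply: eqAmod_trans; rewrite big_mkcondr /= /eqAmod -sumrB.
apply: rpred_sum => w Dw.
have Achi: 'chi_j (w * z)%g \in Aint by apply: Aint_irr.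
have:= theta_mod w^-1%g (groupVr Dw); rewrite /p_elt orderV => /(eqAmodMl Achi).
rewrite eqAmod_sym; case: (_.-nat _); rewrite ?mulr1 ?mulr0; exact.
Qed.

Lemma dvdA_sum_pelt_char (gT : finGroupType) (D : {group gT}) (q : nat)
    (psi : 'CF(D)) (z : gT) :
    prime q -> psi \is a character -> z \in 'Z(D) ->
  ((#|D|`_q)%N %| \sum_(w in D | q.-elt w) psi (w * z)%g)%A.
Proof.
move=> q_pr /char_sum_irr[r ->] Zz.
under eq_bigr do rewrite sum_cfunE.
by rewrite exchange_big rpred_sum // => j _; apply: dvdA_sum_pelt_irr.
Qed.

(** The elements with q'-part z are the w * z with w a q-element of C_G(z), and z
    is central there. *)
Lemma dvdA_sum_char_constt (gT : finGroupType) (G : {group gT}) (q : nat)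
    (psi : 'CF(G)) (z : gT) :
    prime q -> psi \is a character -> z \in G ->
  ((#|'C_G[z]|`_q)%N %| \sum_(x in G | x.`_q^' == z) psi x)%A.
Proof.
move=> q_pr Npsi Gz; have [q'z | nq'z] := boolP (q^'.-elt z); last first.
  rewrite big_pred0 ?rpred0 // => x; apply: contraNF nq'z.
  by case/andP=> _ /eqP<-; apply: p_elt_constt.
have Czz: z \in 'C_G[z] by rewrite inE Gz cent1id.
have ZCz: z \in 'Z('C_G[z]).
  by apply/centerP; split=> // x /setIP[_ /cent1P].
suffices ->: \sum_(x in G | x.`_q^' == z) psi x
    = \sum_(w in 'C_G[z] | q.-elt w) 'Res['C_G[z]] psi (w * z)%g.
  exact: dvdA_sum_pelt_char (cfRes_char _ Npsi) ZCz.
rewrite (reindex_onto (fun w => w * z)%g (fun x => x * z^-1)%g) /=; last first.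
  by move=> x _; rewrite mulgKV.
have in_psection w: (w * z \in G)%g && ((w * z).`_q^' == z)%g
    = (w \in 'C_G[z]) && q.-elt w.
  rewrite groupMr // inE -andbA; apply: andb_id2l => Gw.
  apply/eqP/andP=> [Dz | [/cent1P cwz q_w]]; last first.
    by rewrite consttM // (constt_p_elt q'z) (constt1P _) ?mul1g ?p_eltNK.
  have Dw: ((w * z).`_q = w)%g.
    by apply: (mulIg z); rewrite -{2}Dz consttC.
  split; last by rewrite -Dw p_elt_constt.
  have: commute (w * z).`_q (w * z).`_q^' by apply: commuteX2.
  by rewrite Dw Dz => cwz; apply/cent1P.
apply: eq_big => [w | w /andP[w_sec _]]; first by rewrite mulgK eqxx andbT.
rewrite in_psection in w_sec; case/andP: w_sec => Cw _.
by rewrite cfResE ?subsetIl // groupM.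
Qed.

(** Group the x by the conjugacy class of their q'-part z: the |G : C_G(z)|
    conjugates of z contribute equally, and the q-part of |C_G(z)| divides each
    contribution. *)
Lemma dvdA_sum_mul_char (gT : finGroupType) (G : {group gT}) (q : nat)
    (f : gT -> algC) (psi : 'CF(G)) :
    prime q -> psi \is a character ->
    {in G &, forall x y, f (x ^ y)%g = f x} ->
    {in G, forall x, f x \in Aint} -> {in G, forall x, f x.`_q^' = f x} ->
  ((#|G|`_q)%N %| \sum_(x in G) f x * psi x)%A.
Proof.
move=> q_pr Npsi fJ Af f_q'.
have Gq' x: x \in G -> x.`_q^' \in G by apply: groupX.
rewrite (partition_big (fun x : gT => x.`_q^') (mem G)) //=.
rewrite sum_by_classes => [|z y Gz Gy]; last first.
  rewrite (reindex_inj (conjg_inj y)) /=; apply: eq_big => [x | x /andP[Gx _]].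
    by rewrite groupJr // consttJ (inj_eq (conjg_inj y)).
  by rewrite groupJr // in Gx; rewrite fJ ?cfunJ.
apply: rpred_sum => _ /imsetP[x Gx ->]; set z := repr _.
have [y Gy Dz] : exists2 y, y \in G & z = (x ^ y)%g.
  by apply/imsetP; apply: mem_repr (class_refl G x).
have Gz: z \in G by rewrite Dz groupJ.
have Dcl: (#|x ^: G| * #|'C_G[z]| = #|G|)%N.
  by rewrite -(classGidl x Gy) -Dz -index_cent1 mulnC Lagrange ?subsetIl.
rewrite (eq_bigr (fun u => f z * psi u)) => [|u /andP[Gu /eqP<-]]; last first.
  by rewrite f_q'.
rewrite -mulr_sumr.
have class_gt0: (0 < #|x ^: G|)%N by apply/card_gt0P; exists x; apply: class_refl.
apply: (@dvdA_nat_trans _ (#|x ^: G| * #|'C_G[z]|`_q)).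
- by rewrite muln_gt0 class_gt0 part_gt0.
- by rewrite -Dcl partnM ?cardG_gt0 // dvdn_mul ?dvdn_part.
by rewrite dvdA_natM ?dvdA_mull ?dvdA_sum_char_constt ?Af.
Qed.

(** * Norms of characters on p-sections *)

(** Up to the factor 1 / |G|, the squared norm of the restriction of chi to the
    p-section of v; v is meant to be a p-element. *)
Definition psection_norm (gT : finGroupType) (G : {group gT}) (p : nat)
    (chi : 'CF(G)) (v : gT) : algC :=
  \sum_(x in G | x.`_p \in v ^: G) `|chi x| ^+ 2.

Lemma psection_norm_ge0 (gT : finGroupType) (G : {group gT}) p
    (chi : 'CF(G)) v :
  0 <= psection_norm p chi v.
Proof. by apply: sumr_ge0 => x _; rewrite exprn_ge0. Qed.

Lemma Aint_norm2_char (gT : finGroupType) (G : {group gT}) (chi : 'CF(G)) x :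
  chi \is a character -> `|chi x| ^+ 2 \in Aint.
Proof. by move=> Nchi; rewrite normCK rpredM ?Aint_aut ?Aint_char. Qed.

Lemma psection_norm_Aint (gT : finGroupType) (G : {group gT}) p
    (chi : 'CF(G)) v :
  chi \is a character -> psection_norm p chi v \in Aint.
Proof. by move=> Nchi; apply: rpred_sum => x _; apply: Aint_norm2_char. Qed.

(** For q <> p the p-part of x is also the p-part of its q'-part, so the
    indicator of a p-section is constant on q-sections. *)
Lemma dvdA_psection_norm_p'part (gT : finGroupType) (G : {group gT}) (p : nat)
    (chi : 'CF(G)) (v : gT) :
  chi \is a character -> ((#|G|`_p^')%N %| psection_norm p chi v)%A.
Proof.
move=> Nchi; apply: dvdA_parts => [||q]; rewrite ?part_gt0 ?psection_norm_Aint //.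
rewrite primes_part mem_filter mem_primes => /andP[p'q /andP[q_pr _]].
rewrite partn_part; last by move=> s /eqnP->.
pose f x : algC := (x.`_p \in v ^: G)%:R.
have ->: psection_norm p chi v = \sum_(x in G) f x * (chi * chi^*%CF) x.
  rewrite /psection_norm big_mkcondr; apply: eq_bigr => x Gx.
  by rewrite /f !cfunE normCK; case: ifP; rewrite ?mul1r ?mul0r.
apply: dvdA_sum_mul_char => //.
- by rewrite rpredM ?cfConjC_char.
- by move=> x y Gx Gy; rewrite /f consttJ -class_sym classGidl // class_sym.
- by move=> x _; rewrite rpred_nat.
move=> x _; rewrite /f sub_in_constt // => s _ /eqnP->.
by move: p'q; rewrite !inE eq_sym.
Qed.

(** Multiplying by m^2 / |G| turns the sum over G into the sum over the classes
    of |C_G(x)| |omega(x)|^2, with omega the central character of 'chi_i; a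
    conjugate of v is a power of x, so #[v] divides |C_G(x)|. *)
Lemma dvdA_psection_norm_irr (gT : finGroupType) (G : {group gT}) (p m : nat)
    (i : Iirr G) (v : gT) :
    #|G|%:R = m%:R * 'chi_i 1%g -> v \in G ->
  ((#|G| * #[v])%N %| m%:R ^+ 2 * psection_norm p 'chi_i v)%A.
Proof.
move=> Dm Gv; rewrite /psection_norm big_mkcondr /= sum_by_classes; last first.
  by move=> x y Gx Gy; rewrite consttJ cfunJ // -class_sym classGidl // class_sym.
rewrite mulr_sumr; apply: rpred_sum => _ /imsetP[x0 Gx0 ->]; set x := repr _.
have [y Gy Dx] : exists2 y, y \in G & x = (x0 ^ y)%g.
  by apply/imsetP; apply: mem_repr (class_refl G x0).
have Gx: x \in G by rewrite Dx groupJ.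
rewrite -(classGidl x0 Gy) -Dx.
case: ifP => [/imsetP[t Gt xp_t] | _]; last by rewrite !mulr0 rpred0.
have /dvdnP[k Dk]: (#[v] %| #|'C_G[x]|)%N.
  rewrite -(orderJ v t) -xp_t order_dvdG // inE groupX //=.
  by apply: groupX; apply: cent1id.
have DG: (#|'C_G[x]| * #|x ^: G|)%N = #|G|.
  by rewrite -index_cent1 Lagrange ?subsetIl.
rewrite dvdA_natE ?muln_gt0 ?cardG_gt0 ?order_gt0 //.
pose omega := #|x ^: G|%:R * 'chi_i x / 'chi_i 1%g.
suffices ->: m%:R ^+ 2 * (#|x ^: G|%:R * `|'chi_i x| ^+ 2) / (#|G| * #[v])%:R
   = k%:R * (omega * omega^*).
  have Aomega : omega \in Aint by apply: Aint_class_div_irr1.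
  by rewrite rpredM ?rpred_nat // rpredM // Aint_aut.
have nz1 : 'chi_i 1%g != 0 by apply: irr1_neq0.
have nzv : #[v]%:R != 0 :> algC by rewrite pnatr_eq0 -lt0n.
have [nzk nzc] : k%:R != 0 :> algC /\ #|x ^: G|%:R != 0 :> algC.
  have := cardG_gt0 G; rewrite -DG Dk !muln_gt0 -andbA => /and3P[k_gt0 _ c_gt0].
  by rewrite !pnatr_eq0 -!lt0n.
have chi1_real : ('chi_i 1%g)^* = 'chi_i 1%g.
  by rewrite geC0_conj ?char1_ge0 ?irr_char.
have ->: m%:R = k%:R * #[v]%:R * #|x ^: G|%:R / 'chi_i 1%g.
  by rewrite -!natrM -Dk DG Dm mulfK.
rewrite -DG Dk /omega !natrM normCK !rmorphM fmorphV /= chi1_real rmorph_nat.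
by field; rewrite nzk nzc nzv nz1.
Qed.

(** Generators of U that are conjugate in G are conjugate in N_G(U), and
    centralizing one generator is centralizing U. *)
Lemma card_conj_generators (gT : finGroupType) (G U : {group gT}) (y : gT) :
  (#|[set v | generator U v & y \in v ^: G]| <= #|'N_G(U) : 'C_G(U)|)%N.
Proof.
have [-> | [v0]] := set_0Vmem [set v | generator U v & y \in v ^: G].
  by rewrite cards0.
rewrite inE => /andP[/eqP Uv0 yv0].
have ->: 'C_G(U) = 'C_('N_G(U))[v0].
  rewrite {1}Uv0 cent_cycle setIAC; apply/esym/setIidPl.
  by rewrite Uv0 subcent1_cycle_norm.
rewrite index_cent1; apply/subset_leq_card/subsetP=> v.
rewrite inE => /andP[/eqP Uv yv]; have: v \in v0 ^: G.
  by rewrite -(class_eqP yv0) class_sym.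
case/imsetP=> t Gt Dv; apply/imsetP; exists t => //.
by rewrite inE Gt; apply/normP; rewrite {1}Uv0 -cycleJ -Dv.
Qed.

(** Strict because the p-part of 1 generates no nontrivial group, so that the
    term chi(1)^2 is missing on the left. *)
Lemma sum_psection_norm_lt (gT : finGroupType) (G U : {group gT}) (p : nat)
    (chi : 'CF(G)) :
    chi 1%g != 0 -> U :!=: 1%g ->
  \sum_(v | generator U v) psection_norm p chi v
    < #|'N_G(U) : 'C_G(U)|%:R * \sum_(x in G) `|chi x| ^+ 2.
Proof.
move=> nz_chi1 ntU; rewrite /psection_norm.
rewrite (exchange_big_dep (mem G)) /=; last by move=> v x _ /andP[].
rewrite (eq_bigr (fun x => #|[set v | generator U v & x.`_p \in v ^: G]|%:R
                            * `|chi x| ^+ 2)); last first.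
  move=> x Gx; rewrite sumr_const mulr_natl; congr (_ *+ _).
  by apply: eq_card => v; rewrite !inE unfold_in Gx.
rewrite mulr_sumr [ltLHS](big_setD1 1%g) // [ltRHS](big_setD1 1%g) //=.
apply: ltr_leD; last first.
  apply: ler_sum => x _.
  by rewrite ler_wpM2r ?exprn_ge0 // ler_nat card_conj_generators.
rewrite constt1 eq_card0 ?mul0r => [|v]; last first.
  rewrite !inE; apply: contraNF ntU => /andP[/eqP-> /imsetP[t _ /esym/eqP]].
  by rewrite conjg_eq1 => /eqP->; rewrite cycle1.
by rewrite mulr_gt0 ?exprn_gt0 ?normr_gt0 // ltr0n indexg_gt0.
Qed.

(** * Galois conjugation *)

(** On <[x]> the character chi is a sum of linear characters, whose values are
    roots of unity. *)
Lemma rmorph_char_expg (gT : finGroupType) (G : {group gT}) (chi : 'CF(G))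
    (nu : {rmorphism algC -> algC}) (k : nat) (x : gT) :
    chi \is a character -> x \in G ->
    (forall z, z ^+ #[x] = 1 -> nu z = z ^+ k) ->
  nu (chi x) = chi (x ^+ k)%g.
Proof.
move=> Nchi Gx nu_k; have sxG: <[x]> \subset G by rewrite cycle_subG.
rewrite -(cfResE chi sxG) ?cycle_id // -(cfResE chi sxG) ?mem_cycle //.
have /char_sum_irr[r ->] := cfRes_char <[x]> Nchi.
rewrite !sum_cfunE rmorph_sum; apply: eq_bigr => i _.
have Lchi_i: 'chi_i \is a linear_char by rewrite irr_cyclic_lin ?cycle_cyclic.
rewrite lin_charX ?cycle_id // nu_k // -lin_charX ?cycle_id //.
by rewrite expg_order lin_char1.
Qed.

(** The values of chi at the generators of <[g]> are Galois conjugate. *)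
Lemma char_generator_neq0 (gT : finGroupType) (G : {group gT}) (chi : 'CF(G))
    (g h : gT) :
    chi \is a character -> g \in G -> generator <[g]> h ->
  chi g != 0 -> chi h != 0.
Proof.
move=> Nchi Gg gen_h; have /cycleP[k Dh] := cycle_generator gen_h.
rewrite Dh generator_coprime coprime_sym in gen_h *.
have [nu nu_k] := Qn_aut_exists gen_h.
by rewrite -(rmorph_char_expg Nchi Gg nu_k) fmorph_eq0.
Qed.

(** The element v * g_p' generates <[g]> and lies in the p-section of v. *)
Lemma psection_norm_neq0 (gT : finGroupType) (G : {group gT}) (p : nat)
    (chi : 'CF(G)) (g v : gT) :
    chi \is a character -> g \in G -> chi g != 0 ->
  generator <[g.`_p]> v -> psection_norm p chi v != 0.
Proof.
move=> Nchi Gg nz_g gen_v; pose h := (v * g.`_p^')%g.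
have /eqP Uv := gen_v; have gp_v := cycle_generator gen_v.
have Gv: v \in G by apply: subsetP gp_v; rewrite cycle_subG groupX.
have p_v: p.-elt v := mem_p_elt (p_elt_constt p g) gp_v.
have cvg: commute v g.`_p^'.
  by have /cycleP[k ->] := gp_v; apply/commute_sym/commuteX/commuteX2.
have hp: h.`_p = v.
  rewrite consttM // constt_p_elt // (constt1P _) ?mulg1 //.
  exact: p_elt_constt.
have gen_h: generator <[g]> h.
  have gh: h \in <[g]>.
    by rewrite groupM ?cycle_constt // (subsetP _ v gp_v) // cycle_subG cycle_constt.
  rewrite /generator eq_sym eqEcard cycle_subG gh -!orderE /= -{1}(consttC p g).
  have o_v: #[g.`_p] = #[v] by rewrite /order Uv.
  have co_p: coprime #[v] #[g.`_p^'] by apply: pnat_coprime p_v (p_elt_constt _ _).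
  by rewrite !orderM ?o_v //; apply: commuteX2.
have Gh: h \in G by rewrite groupM ?groupX.
rewrite /psection_norm (bigD1 h) /= ?Gh ?hp ?class_refl // gt_eqF //.
rewrite ltr_pwDl ?sumr_ge0 // => [|x _]; last by rewrite exprn_ge0.
by rewrite exprn_gt0 // normr_gt0 (char_generator_neq0 Nchi Gg gen_h).
Qed.

Lemma Crat_aut_fixed (Qn : splittingFieldType rat)
    (QnC : {rmorphism Qn -> algC}) (a : Qn) :
    galois 1 {:Qn} ->
    (forall nu : {rmorphism algC -> algC}, nu (QnC a) = QnC a) ->
  QnC a \in Crat.
Proof.
move=> galQn fix_a; suffices /vlineP[c ->]: a \in 1%VS.
  by rewrite alg_num_field fmorph_rat rpred_rat.
rewrite -(galois_fixedField galQn); apply/fixedFieldP; first exact: memvf.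
move=> nuQ _; have [nu Dnu] := extend_algC_subfield_aut QnC nuQ.
by apply: (fmorph_inj QnC); rewrite Dnu fix_a.
Qed.

Lemma rmorph_unity_root_expg (n : nat) (nu : {rmorphism algC -> algC}) :
    (0 < n)%N ->
  exists2 k, coprime n k & forall z : algC, z ^+ n = 1 -> nu z = z ^+ k.
Proof.
move=> n_gt0; have [eps pr_eps] := C_prim_root_exists n_gt0.
have pr_nu: n.-primitive_root (nu eps) by rewrite fmorph_primitive_root.
have [k Dk] := prim_rootP pr_eps (prim_expr_order pr_nu).
exists k; first by rewrite Dk prim_root_exp_coprime // coprime_sym in pr_nu.
by move=> z /(prim_rootP pr_eps)[j ->]; rewrite rmorphXn /= Dk exprAC.
Qed.

Lemma rmorph_psection_norm (gT : finGroupType) (G : {group gT}) (p k : nat)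
    (chi : 'CF(G)) (nu : {rmorphism algC -> algC}) (v : gT) :
    chi \is a character -> v \in G -> coprime #|G| k ->
    (forall z, z ^+ #|G| = 1 -> nu z = z ^+ k) ->
  nu (psection_norm p chi v) = psection_norm p chi (v ^+ k)%g.
Proof.
move=> Nchi Gv coGk nu_k.
have nu_chi x: x \in G -> nu (chi x) = chi (x ^+ k)%g.
  move=> Gx; apply: rmorph_char_expg => // z zx1; apply: nu_k.
  by have /dvdnP[j ->] := order_dvdG Gx; rewrite mulnC exprM zx1 expr1n.
have norm2 x: `|chi x| ^+ 2 = chi x * chi x^-1%g by rewrite normCK char_inv.
have XK := expgK coGk.
rewrite /psection_norm rmorph_sum [RHS](reindex_onto (fun x => x ^+ k)%g
   (fun x => x ^+ (expg_invn G k))%g) /=; last first.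
  by move=> x /andP[Gx _]; rewrite -expgM mulnC expgM XK.
apply: eq_big => [x | x /andP[Gx _]]; last first.
  by rewrite !norm2 rmorphM /= !nu_chi ?groupV // expgVn.
have [Gx | notGx] := boolP (x \in G); last first.
  apply/esym/negbTE; apply: contra notGx => /andP[/andP[Gxk _] /eqP <-].
  exact: groupX.
rewrite XK // eqxx andbT groupX //= consttX.
have Gxp: x.`_p \in G by apply: groupX.
apply/imsetP/imsetP=> [] [t Gt Dx]; exists t => //; first by rewrite Dx conjXg.
by apply: (can_in_inj XK); rewrite ?groupJ // Dx conjXg.
Qed.

(** The product lies in the image of the cyclotomic field of |G|-th roots of unity
    and an automorphism only permutes its factors, by a power map on U. *)
Lemma prod_psection_norm_Crat (gT : finGroupType) (G U : {group gT}) (p : nat)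
    (chi : 'CF(G)) :
    chi \is a character -> U \subset G ->
  \prod_(v | generator U v) psection_norm p chi v \in Crat.
Proof.
move=> Nchi sUG.
have norm2 x: `|chi x| ^+ 2 = chi x * chi x^-1%g by rewrite normCK char_inv.
have [Qn galQn [QnC _ [_ _ QnG]]] := group_num_field_exists G.
have /fin_all_exists[a Da] x: exists a, QnC a = chi x.
  have [Gx | notGx] := boolP (x \in G).
    by have [a Da] := QnG _ G chi Nchi x (order_dvdG Gx); exists a.
  by exists 0; rewrite rmorph0 cfun0.
pose b := \prod_(v | generator U v)
  \sum_(x in G | x.`_p \in v ^: G) a x * a x^-1%g.
have Db: QnC b = \prod_(v | generator U v) psection_norm p chi v.
  rewrite rmorph_prod; apply: eq_bigr => v _; rewrite rmorph_sum.
  by apply: eq_bigr => x _; rewrite rmorphM /= !Da -norm2.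
rewrite -Db; apply: Crat_aut_fixed => // nu; rewrite Db rmorph_prod /=.
have [k coGk nu_k] := rmorph_unity_root_expg nu (cardG_gt0 G).
have genU v : generator U v -> v \in U by move=> /eqP->; apply: cycle_id.
have coUk := coprime_dvdl (cardSg sUG) coGk.
have XK := expgK coUk.
rewrite [RHS](reindex_onto (fun v => v ^+ k)%g
   (fun v => v ^+ (expg_invn U k))%g) /=; last first.
  by move=> v /genU Uv; rewrite -expgM mulnC expgM XK.
apply: eq_big => [v | v gen_v]; last first.
  by apply: rmorph_psection_norm => //; apply: (subsetP sUG); apply: genU.
have [Uv | notUv] := boolP (v \in U); last first.
  have /negbTE->: ~~ generator U v by apply: contra notUv => /genU.
  apply/esym/negbTE; apply: contra notUv => /andP[/genU Uvk /eqP <-].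
  exact: groupX.
rewrite XK // eqxx andbT /generator.
have ->: <[v ^+ k]> = <[v]>.
  apply/eqP; rewrite eqEsubset !cycle_subG mem_cycle -{1}(XK v Uv) mem_cycle //.
by [].
Qed.

(** * The local inequalities *)

(** The arithmetic-geometric mean inequality for the algebraic integers X v below,
    whose product is a positive rational integer: their sum is at least their
    number, totient #[u], while [sum_psection_norm_lt] bounds it from above. *)
Lemma totient_order_constt_lt (gT : finGroupType) (G : {group gT}) (g : gT)
    (i : Iirr G) (p m : nat) :
    g \in G -> 'chi_i g != 0 -> p \in \pi(#[g]) ->
    #|G|%:R = m%:R * 'chi_i 1%g ->
  (totient #[g.`_p] * #[g.`_p]
     < #|'N_G(<[g.`_p]>) : 'C_G(<[g.`_p]>)| * m`_p ^ 2)%N.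
Proof.
set u := g.`_p => Gg nz_g p_g Dm; set U := <[u]>%G; set kappa := #|_ : _|.
have Gu: u \in G by apply: groupX.
have sUG: U \subset G by rewrite cycle_subG.
have Nchi := irr_char i; have p_u: p.-elt u by apply: p_elt_constt.
have m_gt0: (0 < m)%N.
  by rewrite lt0n; apply: contra_eqN Dm => /eqP->; rewrite mul0r neq0CG.
pose W := psection_norm p 'chi_i.
pose X v := (m`_p ^ 2)%:R * W v / (#|G| * #[u])%:R.
have Gu_gt0 : (0 < #|G| * #[u])%N by rewrite muln_gt0 cardG_gt0 order_gt0.
have X_ge0 v: 0 <= X v by rewrite divr_ge0 ?mulr_ge0 ?ler0n ?psection_norm_ge0.
have AX v: generator U v -> X v \in Aint.
  move=> /eqP Uv; have Gv: v \in G by rewrite -cycle_subG -Uv.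
  have AW : W v \in Aint by apply: psection_norm_Aint.
  have o_v: #[v] = #[u] by rewrite /order -Uv.
  rewrite -dvdA_natE // -(partnC p (cardG_gt0 G)) mulnAC.
  (* Split |G| #[u] into its p'-part and the p-power |G|_p #[u]. *)
  apply: Gauss_dvdA; rewrite ?muln_gt0 ?part_gt0 ?order_gt0 //.
  - by rewrite coprimeMl coprime_partC /= (pnat_coprime p_u) // part_pnat.
  - apply: (@Gauss_dvdA_cancel _ (m`_p^' ^ 2)%N).
    + by rewrite muln_gt0 part_gt0 order_gt0.
    + by rewrite expn_gt0 part_gt0.
    + rewrite coprimeXr // coprimeMl coprime_partC /=.
      by rewrite (pnat_coprime p_u) ?part_pnat.
    + by rewrite rpredM ?rpred_nat.
    (* The p'-part of m may be cancelled, so the divisibility for m suffices. *)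
    rewrite mulrA -natrM -expnMn mulnC partnC // natrX.
    have:= dvdA_psection_norm_irr p Dm Gv; rewrite o_v.
    by apply: dvdA_nat_trans; rewrite ?dvdn_mul ?dvdn_part.
  by rewrite dvdA_mull ?rpred_nat // dvdA_psection_norm_p'part.
pose gens := [pred v | generator U v].
have Ngens: #|gens| = totient #[u].
  by rewrite totient_gen; apply: eq_card => v; rewrite !inE.
have Sgt0: (0 < #|gens|)%N by rewrite Ngens totient_gt0.
have nzX v: generator U v -> X v != 0.
  move=> Uv; rewrite !mulf_neq0 ?invr_eq0 ?pnatr_eq0 -?lt0n ?expn_gt0 ?part_gt0 //.
  exact: psection_norm_neq0 Nchi Gg nz_g Uv.
have prodX_ge1: 1 <= \prod_(v in gens) X v.
  have X_int: \prod_(v in gens) X v \is a Num.int.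
    apply: Cint_rat_Aint; last exact: rpred_prod.
    rewrite !big_split /= rpredM ?rpredM //=;
      try by rewrite rpred_prod // => v _; rewrite ?rpredV rpred_nat.
    exact: prod_psection_norm_Crat.
  have := norm_intr_ge1 X_int; rewrite ger0_norm ?prodr_ge0 //; apply.
  by apply/prodf_neq0.
have sumX_ge: #|gens|%:R <= \sum_(v in gens) X v.
  rewrite -[leLHS]mul1r -ler_pdivlMr ?ltr0n //.
  rewrite -(expr_ge1 Sgt0) ?divr_ge0 ?ler0n ?sumr_ge0 //.
  by rewrite (le_trans prodX_ge1) // leif_AGM.
have sumX_lt: \sum_(v in gens) X v < (kappa * m`_p ^ 2)%:R / #[u]%:R.
  rewrite /X -mulr_suml -mulr_sumr.
  have: \sum_(v | generator U v) W v < kappa%:R * #|G|%:R.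
    have <-: \sum_(x in G) `|'chi_i x| ^+ 2 = #|G|%:R.
      have /(canRL (mulVKf (neq0CG G))) := cfdot_irr i i.
      by rewrite eqxx mulr1 => <-; apply: eq_bigr => x _; rewrite normCK.
    apply: sum_psection_norm_lt; rewrite ?irr1_neq0 //.
    by rewrite cycle_eq1 -order_gt1 order_constt p_part_gt1.
  move=> sumW_lt; rewrite natrM invfM mulrA ltr_pM2r ?invr_gt0 ?ltr0n ?order_gt0 //.
  rewrite ltr_pdivrMr ?gt0CG // natrM mulrAC [ltLHS]mulrC.
  by rewrite ltr_pM2r // ltr0n expn_gt0 part_gt0.
rewrite -(ltr_nat algC) -Ngens natrM -ltr_pdivlMr ?ltr0n ?order_gt0 //.
exact: le_lt_trans sumX_lt.
Qed.

Lemma index_norm_cent_dvd_totient (gT : finGroupType) (G U : {group gT}) :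
  cyclic U -> (#|'N_G(U) : 'C_G(U)| %| totient #|U|)%N.
Proof.
move=> cycU; rewrite -card_Aut_cyclic //.
have ->: 'C_G(U) = 'N_G(U) :&: 'C(U).
  by rewrite -setIA; congr (_ :&: _); apply/esym/setIidPr/cent_sub.
have := indexgI 'N_G(U)%G 'C(U)%G => /= ->; rewrite -ker_conj_aut.
have := card_morphim (conj_aut U) 'N_G(U)%G.
rewrite (setIidPr (subsetIr _ _)) => <-.
by rewrite cardSg ?Aut_conj_aut.
Qed.

(** The p'-part of k divides p - 1, so k <= p ^ logn p k * (p - 1), and the factors
    p - 1 cancel. *)
Lemma logn_lt_of_totient (p a k b : nat) :
    prime p -> (0 < a)%N -> (k %| totient (p ^ a))%N ->
    (totient (p ^ a) * p ^ a < k * (p ^ b) ^ 2)%N ->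
  (logn p k < a)%N /\ (2 * a <= logn p k + 2 * b)%N.
Proof.
move=> p_pr a_gt0; rewrite totient_pfactor //.
have p_gt1 := prime_gt1 p_pr; have p_gt0 := prime_gt0 p_pr.
have p1_gt0: (0 < p.-1)%N by rewrite -subn1 subn_gt0.
move=> k_dv; have k_gt0: (0 < k)%N.
  by apply: dvdn_gt0 k_dv; rewrite muln_gt0 p1_gt0 expn_gt0 p_gt0.
have p'p1: coprime p p.-1 by apply: coprimenP.
have t_lt: (logn p k < a)%N.
  rewrite -(ltn_predK a_gt0) ltnS -[X in (_ <= X)%N](pfactorK _ p_pr).
  have := dvdn_leq_log p _ k_dv; rewrite lognM ?expn_gt0 ?p_gt0 //.
  rewrite (logn_coprime p'p1) add0n; apply.
  by rewrite muln_gt0 p1_gt0 expn_gt0 p_gt0.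
move=> lt_k; split=> //.
have k_le: (k <= p ^ logn p k * p.-1)%N.
  rewrite -{1}(partnC p k_gt0) p_part leq_mul2l dvdn_leq ?orbT //.
  have: (k`_p^' %| p.-1 * p ^ a.-1)%N by apply: dvdn_trans k_dv; apply: dvdn_part.
  rewrite Gauss_dvdl // coprimeXr // coprime_sym.
  by rewrite (pnat_coprime (pnat_id p_pr)) ?part_pnat.
have:= leq_trans lt_k (leq_mul k_le (leqnn _)).
rewrite -[X in (_ < X)%N]mulnA [X in (_ < X)%N]mulnCA -mulnA ltn_pmul2l //.
rewrite -expnM -!expnD ltn_exp2l //.
lia.
Qed.

(** Here p ^ t is the p-part of |N_G(U) : C_G(U)|, with U generated by g_p. *)
Lemma logn_order_bound (gT : finGroupType) (G : {group gT}) (g : gT)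
    (i : Iirr G) (p m : nat) :
    g \in G -> 'chi_i g != 0 -> p \in \pi(#[g]) ->
    #|G|%:R = m%:R * 'chi_i 1%g ->
  exists t, [/\ (t < logn p #[g])%N, (logn p #[g] + t <= logn p #|G|)%N
               & (2 * logn p #[g] <= t + 2 * logn p m)%N].
Proof.
move=> Gg nz_g p_g Dm.
have p_pr: prime p by move: p_g; rewrite mem_primes => /andP[].
have a_gt0: (0 < logn p #[g])%N by rewrite logn_gt0.
have := totient_order_constt_lt Gg nz_g p_g Dm.
set U := <[g.`_p]>%G; have sUG: U \subset G by rewrite cycle_subG groupX.
have := index_norm_cent_dvd_totient G (cycle_cyclic g.`_p).
rewrite -[#|<[g.`_p]>|]/(#[g.`_p]) order_constt !p_part => k_dv k_lt.
have [t_lt a_le] := logn_lt_of_totient p_pr a_gt0 k_dv k_lt.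
set k := #|_ : _| in t_lt a_le *; exists (logn p k); split=> //.
have Dk: (#|'C_G(U)| * k)%N = #|'N_G(U)|.
  by apply: Lagrange; rewrite setIS ?cent_sub.
have U_C: U \subset 'C_G(U) by rewrite subsetI sUG -abelianE cycle_abelian.
have k_gt0 : (0 < k)%N by apply: indexg_gt0.
apply: leq_trans (dvdn_leq_log p (cardG_gt0 G) (cardSg (subsetIl G 'N(U)))).
rewrite -Dk lognM ?cardG_gt0 // leq_add2r.
have := dvdn_leq_log p (cardG_gt0 _) (cardSg U_C).
by rewrite -[#|U|]/(#[g.`_p]) order_constt p_part pfactorK.
Qed.

(** * Divisibility prime by prime *)

Lemma squarefree_part_gt0 (n : nat) : (0 < squarefree_part n)%N.
Proof.
rewrite /squarefree_part big_seq_cond prodn_cond_gt0 // => q /andP[].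
by rewrite mem_primes => /andP[/prime_gt0].
Qed.

Lemma logn_squarefree_part (n p : nat) :
  prime p -> logn p (squarefree_part n) = (p \in primes n).
Proof.
move=> p_pr; pose r := [seq q <- primes n | q != p].
have p'r: logn p (\prod_(q <- r) q) = 0%N.
  apply: logn_coprime; rewrite big_seq.
  elim/big_rec: _ => [|q x]; first exact: coprimen1.
  rewrite mem_filter mem_primes => /and3P[q'p q_pr _] co_px.
  by rewrite coprimeMr co_px andbT prime_coprime // dvdn_prime2 1?eq_sym.
rewrite /squarefree_part; have [np | p'n] := boolP (p \in primes n); last first.
  suffices <-: r = primes n by [].
  by apply/all_filterP/allP=> q nq; apply: contraNneq p'n => <-.
rewrite (bigD1_seq p) ?primes_uniq //= -big_filter -/r.
rewrite lognM ?(prime_gt0 p_pr) //; first by rewrite logn_prime // eqxx p'r.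
rewrite big_seq prodn_cond_gt0 // => q; rewrite mem_filter mem_primes.
by case/and3P=> _ /prime_gt0.
Qed.

Lemma dvdn_logn (m n : nat) :
    (0 < m)%N -> (0 < n)%N ->
  (forall p, prime p -> (logn p m <= logn p n)%N) -> (m %| n)%N.
Proof.
move=> m_gt0 n_gt0 le_mn; apply/dvdn_partP=> // p.
by rewrite mem_primes => /andP[p_pr _]; rewrite p_part pfactor_dvdn // le_mn.
Qed.

Theorem theorem2p1 (gT : finGroupType) (G : {group gT}) (g : gT) (i : Iirr G)
    (gG : g \in G) (chi_g_neq0 : 'chi[G]_i g != 0) :
  (((#[g]%g * squarefree_part #[g]%g)%N%:R : algC)
     %| (#|G|%:R / 'chi[G]_i 1%g) ^+ 2)%C
  /\ (((#[g]%g ^ 3)%N%:R : algC) %| #|G|%:R ^+ 3 / 'chi[G]_i 1%g ^+ 2)%C.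
Proof.
have nz1 := irr1_neq0 i.
have [||m Dm] := dvdCP_nat _ _ (dvd_irr1_cardG i).
- by rewrite char1_ge0 ?irr_char.
- exact: ler0n.
have{Dm} Dm: #|G|%:R = m%:R * 'chi_i 1%g by [].
have m_gt0: (0 < m)%N.
  by rewrite lt0n; apply: contra_eqN Dm => /eqP->; rewrite mul0r neq0CG.
have ->: #|G|%:R ^+ 3 / 'chi_i 1%g ^+ 2 = (#|G| * m ^ 2)%:R :> algC.
  by rewrite natrM natrX exprS -mulrA -expr_div_n {2}Dm mulfK.
rewrite Dm mulfK // -natrX !dvdC_nat.
have bound p p_g := @logn_order_bound _ G g i p m gG chi_g_neq0 p_g Dm.
have n_gt0 := order_gt0 g; have G_gt0 := cardG_gt0 G.
have s_gt0 := squarefree_part_gt0 #[g].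
split; apply: dvdn_logn;
  rewrite ?muln_gt0 ?expn_gt0 ?n_gt0 ?m_gt0 ?G_gt0 // => p p_pr.
  rewrite lognM // lognX logn_squarefree_part //.
  have [p_g | p'g] := boolP (p \in primes #[g]).
    have [t [lt_ta _ le_ab]] := bound p p_g; lia.
  by move: p'g; rewrite -logn_gt0 lt0n negbK => /eqP->.
rewrite lognM ?expn_gt0 ?m_gt0 // !lognX.
have [p_g | p'g] := boolP (p \in primes #[g]).
  have [t [lt_ta le_aG le_ab]] := bound p p_g; lia.
by move: p'g; rewrite -logn_gt0 lt0n negbK => /eqP->.
Qed.
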